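(* Let $r\ge1$ and $\mathbf c\in\mathbb N^r$. Let $\overline{\mathrm{Cond}(\mathbf c)}$ be the set of all multiplicity trees (twisted or untwisted) of local Arf good semigroups in $\mathbb N^r$ with conductor $\mathbf c$, and let $S^r$ be the symmetric group on $\{1,\ldots,r\}$. Then $$\overline{\mathrm{Cond}(\mathbf c)}=\bigcup_{\sigma\in S^r}\{\sigma^{-1}(T): T\in\mathrm{Cond}(\sigma(\mathbf c))\}.$$
   Context: $\mathbb N$ contains $0$; $v[i]$ is the $i$-th component of $v$; $\mathbb N^r$ has the componentwise partial order. A good semigroup $S\subseteq\mathbb N^r$ is a submonoid such that: (1) $\min(a,b)\in S$ (componentwise) for $a,b\in S$; (2) if $a,b\in S$ and $a[i]=b[i]$, there is $c\in S$ with $c[i]>a[i]$, $c[j]\ge\min(a[j],b[j])$ for $j\ne i$, with equality if $a[j]\ne b[j]$; (3) there is $\delta\in S$ with $\delta+\mathbb N^r\subseteq S$. Its conductor is the minimal vector $\mathbf c$ with $\mathbf c+\mathbb N^r\subseteq S$. It is local if the zero vector is its only element with some zero component. It is Arf if $\{\beta\in S:\beta\ge\alpha\}-\alpha$ is a semigroup for every $\alpha\in S$. A local Arf good semigroup $S\subseteq \mathbb N^r$ is determined by its multiplicity tree $T$: a rooted tree with $r$ infinite branches, whose nodes are vectors $\mathbf n_i^j\in\mathbb N^r$ ($\mathbf n_i^j$ is the node of the $i$-th branch at level $j\ge1$; all branches share the root $\mathbf n_1^1$), with $S=\{\mathbf 0\}\cup\{\sum_{\mathbf n\in T'}\mathbf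 n : T' \text{ a finite subtree of } T \text{ rooted in } \mathbf n_1^1\}$. A tree is a multiplicity tree of a local Arf good semigroup iff: there is $L$ such that for $m\ge L$, $\mathbf n_i^m$ is the $i$-th unit vector for all $i$; $\mathbf n_i^j[h]=0$ iff $\mathbf n_i^j$ is not in the $h$-th branch; and each $\mathbf n_i^j$ equals the sum of the nodes different from $\mathbf n_i^j$ of some finite subtree rooted in $\mathbf n_i^j$. Two branches are glued at level $j$ if they share their node at level $j$; $p_{i,j}$ ($i<j$) denotes the highest level at which the $i$-th and $j$-th branches are glued. The tree is untwisted if two non-consecutive branches are glued at level $l$ if and only if all the consecutive branches between them are glued at a level $\ge l$, equivalently $p_{i,j}=\min\{p_{i,i+1},\ldots,p_{j-1,j}\}$ for all $i<j$; otherwise it is twisted. $\mathrm{Cond}(\mathbf c)$ is the set of untwisted multiplicity trees of local Arf good semigroups in $\mathbb N^r$ with conductor $\mathbf c$. A permutation $\sigma\in S^r$ acts on $\mathbb N^r$ by permuting coordinates, $\sigma(v)[\sigma(i)]=v[i]$, and on trees by applying $\sigma$ to every node, the $i$-th branch of $T$ becoming the $\sigma(i)$-th branch of $\sigma(T)$. *)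

(* Defs.v *)
From mathcomp Require Import all_boot all_order all_algebra all_fingroup.
From mathcomp Require Import finmap.
From mathcomp Require Import boolp classical_sets.
Set Implicit Arguments.
Unset Strict Implicit.
Unset Printing Implicit Defensive.
Import GRing.Theory.
Local Open Scope classical_set_scope.
Local Open Scope ring_scope.

(* Vectors of N^r, with the pointwise additive monoid structure of {ffun _}. *)
Notation vec r := {ffun 'I_r -> nat}.

Section Semigroups.
Variable r : nat.
Implicit Types (S : set (vec r)) (a b c d v : vec r).

Definition vec_le a b : Prop := forall i, (a i <= b i)%N.

Definition vec_min a b : vec r := [ffun i => minn (a i) (b i)].

Definition add_closed S : Prop := forall a b, S a -> S b -> S (a + b).

Definition submonoid S : Prop := S 0 /\ add_closed S.

(* c + N^r is included in S. *)
Definition orthant_in S c : Prop := forall v, S (c + v).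

Definition good_semigroup S : Prop :=
  [/\ submonoid S,
      forall a b, S a -> S b -> S (vec_min a b),
      forall a b (i : 'I_r), S a -> S b -> a i = b i ->
        exists c, [/\ S c, (a i < c i)%N &
          forall j, j != i ->
            (minn (a j) (b j) <= c j)%N /\
            (a j <> b j -> c j = minn (a j) (b j))] &
      exists2 d, S d & orthant_in S d].

Definition is_conductor S c : Prop :=
  orthant_in S c /\ forall d, orthant_in S d -> vec_le c d.

Definition local S : Prop := forall a, S a -> forall i, a i = 0%N -> a = 0.

(* {b in S | b >= a} - a: an element b >= a is written a + d with d in N^r. *)
Definition shifted S a : set (vec r) := [set d | S (a + d)].

Definition Arf S : Prop := forall a, S a -> add_closed (shifted S a).

End Semigroups.

(* [T i j] is the node of the i-th branch at level j.  Branches and levels are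
   both numbered from 0, so the root is at level 0. *)
Notation branches r := ('I_r -> nat -> vec r).

Section Trees.
Variable r : nat.
Implicit Types (T : branches r) (S : set (vec r)).

Definition glued T (i h : 'I_r) (j : nat) : Prop := T i j = T h j.

(* The nodes at distinct levels are distinct even if they carry the same
   vector, so that a node is identified with its level paired with its vector. *)
Definition node T (i : 'I_r) (j : nat) : nat * vec r := (j, T i j).

(* The branches share the root, and a node has only one parent. *)
Definition rooted_tree T : Prop :=
  (forall i h, glued T i h 0) /\
  (forall i h j, glued T i h j.+1 -> glued T i h j).

(* F contains x, and any other member of F has its parent in F; as levels are
   bounded below, F then consists of x and descendants of x. *)
Definition finite_subtree T (x : nat * vec r) (F : {fset nat * vec r}) : Prop :=
  x \in F /\
  forall y, y \in F -> y != x ->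
    exists i j, y = node T i j.+1 /\ node T i j \in F.

Definition unit_vec (i : 'I_r) : vec r := [ffun h => nat_of_bool (h == i)].

Definition multiplicity_tree T : Prop :=
  [/\ rooted_tree T,
      exists L, forall m i, (L <= m)%N -> T i m = unit_vec i,
      forall i j h, T i j h = 0%N <-> ~ glued T i h j &
      forall i j, exists2 F : {fset nat * vec r},
        finite_subtree T (node T i j) F &
        T i j = \sum_(y <- F | y != node T i j) y.2].

Definition tree_semigroup T : set (vec r) :=
  [set 0] `|`
  [set v | exists i (F : {fset nat * vec r}),
     finite_subtree T (node T i 0) F /\ v = \sum_(y <- F) y.2].

Definition multiplicity_tree_of S T : Prop :=
  multiplicity_tree T /\ S = tree_semigroup T.

Definition untwisted T : Prop :=
  forall (i j : 'I_r) (l : nat), (i.+1 < j)%N ->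
    glued T i j l <->
    forall k k' : 'I_r, k' = k.+1 :> nat -> (i <= k)%N -> (k' <= j)%N ->
      exists2 l', (l <= l')%N & glued T k k' l'.

(* All multiplicity trees, twisted or not. *)
Definition CondBar (c : vec r) : set (branches r) :=
  [set T | exists S, [/\ good_semigroup S, local S, Arf S, is_conductor S c &
                         multiplicity_tree_of S T]].

Definition Cond (c : vec r) : set (branches r) :=
  CondBar c `&` [set T | untwisted T].

Definition vec_perm (s : 'S_r) (v : vec r) : vec r :=
  [ffun k => v (s^-1%g k)].

Definition tree_perm (s : 'S_r) T : branches r :=
  fun i j => vec_perm s (T (s^-1%g i) j).

Lemma vec_permE s v i : vec_perm s v (s i) = v i.
Proof. by rewrite ffunE permK. Qed.

Lemma tree_permE s T i j : tree_perm s T (s i) j = vec_perm s (T i j).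
Proof. by rewrite /tree_perm permK. Qed.

End Trees.

(* Main.v *)
Require Import Defs.
From mathcomp Require Import all_boot all_order all_algebra all_fingroup.
From mathcomp Require Import finmap.
From mathcomp Require Import boolp classical_sets.
Import Order.TTheory.
Local Open Scope classical_set_scope.

(** Relabelling the coordinates transports every condition defining
    [CondBar c] to the corresponding one for the permuted conductor, so it
    remains to untwist an arbitrary tree.  This is done by listing its branches
    in the lexicographic order of their node sequences: branches glued at level
    [l] share a prefix of length [l + 1], and the sequences with a given prefix
    form an interval of the lexicographic order. *)

Section Permutation.
Set Implicit Arguments.
Unset Strict Implicit.
Local Open Scope ring_scope.
Variable r : nat.
Implicit Types (s : 'S_r) (T : branches r) (S : set (vec r)) (a b c v : vec r).

Lemma vec_permK s : cancel (vec_perm s) (vec_perm s^-1).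
Proof. by move=> v; apply/ffunP=> i; rewrite !ffunE invgK permK. Qed.

Lemma vec_permKV s : cancel (vec_perm s^-1) (vec_perm s).
Proof. by move=> v; rewrite -{1}[s]invgK vec_permK. Qed.

Lemma vec_perm_inj s : injective (vec_perm s).
Proof. exact: can_inj (vec_permK s). Qed.

Lemma vec_permD s : {morph vec_perm s : a b / a + b}.
Proof. by move=> a b; apply/ffunP=> i; rewrite !ffunE. Qed.

Lemma vec_perm0 s : vec_perm s 0 = 0.
Proof. by apply/ffunP=> i; rewrite !ffunE. Qed.

Lemma vec_perm_min s a b :
  vec_perm s (vec_min a b) = vec_min (vec_perm s a) (vec_perm s b).
Proof. by apply/ffunP=> i; rewrite !ffunE. Qed.

Lemma vec_perm_unit s i : vec_perm s (unit_vec i) = unit_vec (s i).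
Proof.
by apply/ffunP=> h; rewrite !ffunE -{2}(permKV s h) (inj_eq perm_inj).
Qed.

Lemma tree_permK s T : tree_perm s^-1 (tree_perm s T) = T.
Proof.
by apply/funext=> i; apply/funext=> j; rewrite /tree_perm invgK permK vec_permK.
Qed.

Lemma glued_perm s T i h j :
  glued (tree_perm s T) i h j <-> glued T (s^-1%g i) (s^-1%g h) j.
Proof. by split=> [/vec_perm_inj|] // E; congr vec_perm. Qed.

(** The image of [S] under [vec_perm s], written as a preimage under the inverse so that membership
    unfolds without a witness. *)
Definition set_perm s S : set (vec r) := [set v | S (vec_perm s^-1 v)].

Lemma orthant_in_perm s S c :
  orthant_in S c -> orthant_in (set_perm s S) (vec_perm s c).
Proof. by move=> Sc v; rewrite /set_perm /= vec_permD vec_permK. Qed.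

Lemma good_semigroup_perm s S :
  good_semigroup S -> good_semigroup (set_perm s S).
Proof.
move=> [[S0 SD] Smin Sexch [d Sd Od]]; split.
- split=> [|a b Sa Sb]; first by rewrite /set_perm /= vec_perm0.
  by rewrite /set_perm /= vec_permD; apply: SD.
- by move=> a b Sa Sb; rewrite /set_perm /= vec_perm_min; apply: Smin.
- move=> a b i Sa Sb ab.
  have [|e [Se lte He]] := Sexch _ _ (s^-1%g i) Sa Sb.
    by rewrite !vec_permE.
  exists (vec_perm s e); split; first by rewrite /set_perm /= vec_permK.
    by move: lte; rewrite vec_permE ffunE.
  move=> j ji; have := He (s^-1%g j).
  rewrite (inj_eq perm_inj) !vec_permE ffunE; exact.
- exists (vec_perm s d); first by rewrite /set_perm /= vec_permK.
  exact: orthant_in_perm.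
Qed.

Lemma local_perm s S : local S -> local (set_perm s S).
Proof.
move=> Sloc a Sa i ai0; apply: (@vec_perm_inj s^-1); rewrite vec_perm0.
by apply: (Sloc _ Sa (s^-1%g i)); rewrite vec_permE.
Qed.

Lemma Arf_perm s S : Arf S -> Arf (set_perm s S).
Proof.
move=> SA a Sa b d; rewrite /shifted /set_perm /= !vec_permD.
exact: SA.
Qed.

Lemma is_conductor_perm s S c :
  is_conductor S c -> is_conductor (set_perm s S) (vec_perm s c).
Proof.
move=> [Oc minc]; split=> [|d Od i]; first exact: orthant_in_perm.
(* Minimality of [c] is a property of [S], so the competing vector [d] is pulled back to [S]
   first. *)
have /minc/(_ (s^-1%g i)) : orthant_in S (vec_perm s^-1 d).
  by move=> v; have := Od (vec_perm s v); rewrite /set_perm /= vec_permD vec_permK.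
by rewrite vec_permE ffunE.
Qed.

Definition node_perm s (y : nat * vec r) := (y.1, vec_perm s y.2).

Lemma node_perm_inj s : injective (node_perm s).
Proof. by move=> [j a] [k b] [-> /vec_perm_inj ->]. Qed.

Lemma node_permE s T i j : node (tree_perm s T) (s i) j = node_perm s (node T i j).
Proof. by rewrite /node tree_permE. Qed.

Local Notation subtree_perm s F := [fset node_perm s y | y in F]%fset.

Lemma finite_subtree_perm s T x (F : {fset nat * vec r}) :
  finite_subtree T x F ->
  finite_subtree (tree_perm s T) (node_perm s x) (subtree_perm s F).
Proof.
move=> [xF parF]; split=> [|_ /imfsetP[y /= yF ->]].
  by apply/imfsetP; exists x.
rewrite (inj_eq (@node_perm_inj s)) => /(parF _ yF)[i [j [-> ijF]]].
exists (s i), j; rewrite !node_permE; split=> //.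
by apply/imfsetP; exists (node T i j).
Qed.

(** The filter [P] serves two uses: leaving out the root of the subtree in [multiplicity_tree], and
    the full sum in [tree_semigroup]. *)
Lemma sum_subtree_perm s (P : pred (nat * vec r)) (F : {fset nat * vec r}) :
  \sum_(y <- subtree_perm s F | P y) y.2 =
  vec_perm s (\sum_(y <- F | P (node_perm s y)) y.2).
Proof.
rewrite (big_morph _ (vec_permD s) (vec_perm0 s)).
by rewrite big_mkcond big_imfset -?big_mkcond //= => x y _ _; apply: node_perm_inj.
Qed.

Lemma multiplicity_tree_perm s T :
  multiplicity_tree T -> multiplicity_tree (tree_perm s T).
Proof.
move=> [[root par] [L TL] T0 TF]; split.
- by split=> [i h|i h j]; rewrite !glued_perm; [apply: root | apply: par].
- by exists L => m i Lm; rewrite /tree_perm TL // vec_perm_unit permKV.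
- by move=> i j h; rewrite glued_perm -T0 ffunE.
- move=> i j; have [F FT TE] := TF (s^-1%g i) j; exists (subtree_perm s F).
    by rewrite -(permKV s i) node_permE; apply: finite_subtree_perm.
  rewrite sum_subtree_perm /tree_perm TE; congr vec_perm.
  by apply: eq_bigl => y; rewrite -(inj_eq (@node_perm_inj s)) -node_permE permKV.
Qed.

Lemma tree_semigroup_perm_sub s T v :
  tree_semigroup T v -> tree_semigroup (tree_perm s T) (vec_perm s v).
Proof.
case=> [->|[i [F [FT ->]]]]; first by left; apply: vec_perm0.
right; exists (s i), (subtree_perm s F); rewrite sum_subtree_perm node_permE.
by split=> //; apply: finite_subtree_perm.
Qed.

Lemma tree_semigroup_perm s T :
  tree_semigroup (tree_perm s T) = set_perm s (tree_semigroup T).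
Proof.
apply/seteqP; split=> v.
  (* The same inclusion, used for the inverse permutation, gives the converse one. *)
  by move=> /(tree_semigroup_perm_sub s^-1); rewrite tree_permK.
by move=> /(tree_semigroup_perm_sub s); rewrite vec_permKV.
Qed.

Lemma CondBar_perm s c T :
  CondBar c T -> CondBar (vec_perm s c) (tree_perm s T).
Proof.
move=> [S [gS lS aS cS [mT ST]]]; exists (set_perm s S); split.
- exact: good_semigroup_perm.
- exact: local_perm.
- exact: Arf_perm.
- exact: is_conductor_perm.
- by split; [exact: multiplicity_tree_perm | rewrite ST tree_semigroup_perm].
Qed.

End Permutation.

(** Induction on the prefix length: equal outer heads squeeze the middle head, and the comparisons
    then pass to the tails. *)
Lemma lexi_prefix_convex m (x y z : seqlexi nat) :
  (x <= y)%O -> (y <= z)%O -> take m x = take m z -> take m x = take m y.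
Proof.
elim: m x y z => [|m IH] [|a x] [|b y] [|d z] //=.
rewrite !lexi_cons => /andP[ab /implyP xy] /andP[bd /implyP yz] [ad E].
move: ad bd yz => <- ba yz.
have eab : a = b by apply/le_anti/andP.
by rewrite -eab in yz xy *; rewrite (IH x y z) ?xy ?yz.
Qed.

Lemma sorting_perm r (R : rel 'I_r) :
  total R -> transitive R ->
  exists p : 'S_r, forall i j : 'I_r, i <= j -> R (p i) (p j).
Proof.
move=> Rtot Rtr; set t := sort R (enum 'I_r).
have szt : size t = r by rewrite size_sort size_enum_ord.
(* The default [i] is never returned, as [t] has size [r]; it only supplies an element of ['I_r],
   which may be empty. *)
have inj : injective (fun i : 'I_r => nth i t i).
  move=> i j /eqP; rewrite (set_nth_default i j) ?szt //.
  by rewrite nth_uniq ?szt ?sort_uniq ?enum_uniq // => /eqP/val_inj.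
exists (perm inj) => i j ij; rewrite !permE (set_nth_default i j) ?szt //.
apply: sorted_leq_nth => //; rewrite ?inE ?szt //.
  by move=> x; have := Rtot x x; rewrite orbb.
exact: sort_sorted.
Qed.

Lemma untwisting_perm r (T : branches r) :
  multiplicity_tree T -> exists s : 'S_r, untwisted (tree_perm s T).
Proof.
move=> [[root par] [L TL] _ _].
(* Any injective coding of vectors by naturals gives a usable order. Cutting at [L] loses no gluing,
   because from level [L] on the branches carry distinct unit vectors. *)
pose key i : seqlexi nat := mkseq (fun j => choice.pickle (T i j)) L.
have glued_lt i h l : i != h -> glued T i h l -> l < L.
  move=> ih; rewrite ltnNge /glued; apply: contraPN => Ll.
  rewrite !TL // => /ffunP/(_ i); rewrite !ffunE eqxx.
  by rewrite (negPf ih).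
have glued_le i h l m : m <= l -> glued T i h l -> glued T i h m.
  by move=> /subnK <-; elim: (l - m) => // n IH /par.
have take_key l i : l < L ->
    take l.+1 (key i) = mkseq (fun j => choice.pickle (T i j)) l.+1.
  by move=> lL; rewrite /key /mkseq -map_take take_iota (minn_idPl lL).
(* The length is [l.+1] because levels start at 0. Gluing descends to all lower levels, giving equal
   prefixes; conversely, the last entry of the prefix codes the node at level [l]. *)
have glued_key l i h : l < L ->
    glued T i h l <-> take l.+1 (key i) = take l.+1 (key h).
  move=> lL; rewrite !take_key //; split=> [gl|E].
    apply/eq_in_map => m; rewrite mem_iota /= add0n ltnS => ml.
    by congr choice.pickle; apply: glued_le gl.
  apply: (pcan_inj choice.pickleK); have := congr1 (fun s => nth 0 s l) E.
  by rewrite !nth_mkseq.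
(* Branches glued at all levels below [L] have equal keys, so this relation is in general only a
   total preorder on indices. *)
have [||p pP] := @sorting_perm r (fun i j => (key i <= key j)%O).
- by move=> i j; apply: le_total.
- by move=> j i k; apply: le_trans.
(* [tree_perm s] sends branch [i] to position [s i], so the inverse of [p] puts branch [p i] at
   position [i]. *)
exists p^-1%g => i j l ij; rewrite glued_perm invgK.
have ltij : i < j by apply: ltnW.
split=> [gl k k' k'E ik k'j | gl].
  exists l => //; rewrite glued_perm invgK.
  have lL : l < L.
    by apply: glued_lt gl; rewrite (inj_eq perm_inj) neq_ltn ltij.
  (* Every branch listed between positions [i] and [j] shares their common prefix, by convexity. *)
  have glk (h : 'I_r) : i <= h -> h <= j -> glued T (p i) (p h) l.
    move=> ih hj; apply/glued_key => //.
    have /(glued_key _ _ _ lL) Eij := gl.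
    exact: lexi_prefix_convex (pP _ _ ih) (pP _ _ hj) Eij.
  have kj : k <= j by rewrite ltnW // -k'E.
  have ik' : i <= k' by rewrite k'E leqW.
  by rewrite /glued -(glk k) // (glk k').
(* Conversely, gluings of consecutive branches are lowered to level [l] and chained, by induction on
   the distance [n] from [i]. *)
have glk n (h : 'I_r) : h = i + n :> nat -> h <= j -> glued T (p i) (p h) l.
  elim: n h => [|n IH] h hE hj.
    by rewrite (_ : h = i) //; apply: val_inj; rewrite /= hE addn0.
  have lt_r : i + n < r by rewrite (leq_trans _ (ltn_ord h)) // hE addnS.
  have [] := gl (Ordinal lt_r) h _ _ hj; rewrite /= ?leq_addr ?hE ?addnS //.
  move=> l' ll'; rewrite glued_perm invgK => /(glued_le _ _ _ _ ll').
  by apply: etrans; apply: IH; rewrite //= (leq_trans _ hj) // hE addnS.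
by apply: (glk (j - i)); rewrite // subnKC // ltnW.
Qed.

Theorem mainTheorem4 (r : nat) (hr : (1 <= r)%N) (c : {ffun 'I_r -> nat}) :
  CondBar c =
  \bigcup_(s in [set: 'S_r])
    [set tree_perm (s^-1)%g T | T in Cond (vec_perm s c)].
Proof.
apply/seteqP; split=> [T cT|_ [s _ [T [cT _] <-]]].
  have [S [_ _ _ _ [mT _]]] := cT.
  have [s us] := untwisting_perm mT.
  exists s => //; exists (tree_perm s T); last exact: tree_permK.
  by split=> //; apply: CondBar_perm.
(* Transporting by the inverse permutation brings the conductor back to [c]. *)
by rewrite -(vec_permK s c); apply: CondBar_perm.
Qed.
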